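(* Let $\nu\ge 0$ and $\alpha>-1$, and put $P_{2n}(x)=p_{n,n}^{\alpha}(x)$ and $P_{2n+1}(x)=p_{n+1,n}^{\alpha}(x)$ for integers $n\ge 0$, where $p_{n,m}^{\alpha}$ are the (monic) type 2 multiple orthogonal polynomials for the pair $(\rho_\nu,\rho_{\nu+1})$; put also $P_{-1}=P_{-2}=0$. Then for every integer $n\ge 0$ $$xP_n(x)=P_{n+1}(x)+b_nP_n(x)+c_nP_{n-1}(x)+d_nP_{n-2}(x),$$ where the recurrence coefficients are given by $$b_n=(n+\alpha+1)(3n+\alpha+2\nu)-(\alpha+1)(\nu-1),$$ $$c_n=n(n+\alpha)(n+\alpha+\nu)(3n+2\alpha+\nu),$$ $$d_n=n(n-1)(n+\alpha-1)(n+\alpha)(n+\alpha+\nu-1)(n+\alpha+\nu).$$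
   Context: $K_\nu$ is the Macdonald function (modified Bessel function of the second kind), given for $z>0$ by $K_\nu(z)=\frac12\left(\frac z2\right)^{\nu}\int_0^\infty \exp\left(-t-\frac{z^2}{4t}\right)t^{-\nu-1}\,dt$. For $x>0$ the scaled Macdonald function is $\rho_\nu(x)=2x^{\nu/2}K_\nu(2\sqrt{x})$. Throughout $\nu\ge 0$. For nonnegative integers $n,m$ and $\alpha>-1$, the type 2 multiple orthogonal polynomial $p_{n,m}^{\alpha}$ (with $\nu$ fixed) is the monic polynomial of degree $n+m$ satisfying $$\int_0^\infty p_{n,m}^{\alpha}(x)\rho_\nu(x)x^{k+\alpha}\,dx=0,\quad k=0,1,\ldots,n-1,$$ $$\int_0^\infty p_{n,m}^{\alpha}(x)\rho_{\nu+1}(x)x^{k+\alpha}\,dx=0,\quad k=0,1,\ldots,m-1.$$ For the indices used here ($(n,n)$ and $(n+1,n)$) this polynomial exists and is unique. *)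

(* Defs.v *)
(* MathComp-Analysis; integrals are Lebesgue integrals over an abstract
   R : realType. *)
From mathcomp Require Import all_boot all_order all_algebra.
From mathcomp Require Import all_classical all_reals all_analysis.

Set Implicit Arguments.
Unset Strict Implicit.
Unset Printing Implicit Defensive.

Import Order.TTheory GRing.Theory Num.Theory.

Local Open Scope classical_set_scope.
Local Open Scope ring_scope.

(* Real-valued integral; only meant for z > 0, where it converges. *)
Definition macdonald (R : realType) (nu z : R) : R :=
  2^-1 * (z / 2) `^ nu *
  \int[lebesgue_measure]_(t in `]0, +oo[)
     (expR (- t - z ^+ 2 / (4 * t)) * t `^ (- nu - 1)).

Definition scaled_macdonald (R : realType) (nu x : R) : R :=
  2 * x `^ (nu / 2) * macdonald nu (2 * Num.sqrt x).

(* The integral is taken in \bar R: it equals 0 only when it is well defined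
   and finite, with no default value involved. *)
Definition orthogonal_upto (R : realType) (w : R -> R) (alpha : R) (n : nat)
    (p : {poly R}) : Prop :=
  forall k : nat, (k < n)%N ->
    (\int[lebesgue_measure]_(x in `]0%R, +oo[)
       (p.[x] * w x * x `^ (k%:R + alpha))%:E = 0)%E.

Definition is_type2_mop (R : realType) (nu alpha : R) (n m : nat)
    (p : {poly R}) : Prop :=
  [/\ p \is monic, size p = (n + m).+1,
      orthogonal_upto (scaled_macdonald nu) alpha n p &
      orthogonal_upto (scaled_macdonald (nu + 1)) alpha m p].

Definition coef_b (R : realType) (nu alpha : R) (n : nat) : R :=
  (n%:R + alpha + 1) * (3 * n%:R + alpha + 2 * nu) - (alpha + 1) * (nu - 1).

Definition coef_c (R : realType) (nu alpha : R) (n : nat) : R :=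
  n%:R * (n%:R + alpha) * (n%:R + alpha + nu) * (3 * n%:R + 2 * alpha + nu).

Definition coef_d (R : realType) (nu alpha : R) (n : nat) : R :=
  n%:R * (n%:R - 1) * (n%:R + alpha - 1) * (n%:R + alpha) *
  (n%:R + alpha + nu - 1) * (n%:R + alpha + nu).

(* Main.v *)
Require Import Defs.
From mathcomp Require Import all_boot all_order all_algebra.
From mathcomp Require Import all_classical all_reals all_analysis.
From mathcomp Require Import measurable_realfun.
From mathcomp Require Import ring zify.

Set Implicit Arguments.
Unset Strict Implicit.
Unset Printing Implicit Defensive.

Import Order.TTheory GRing.Theory Num.Theory.
Import numFieldNormedType.Exports.

Local Open Scope ring_scope.

(** Put [a = alpha + 1] and [c = alpha + nu + 1].  A double integral gives the
    moments: the integral of [x^(k + alpha) rho_nu(x)] over the half-line is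
    Gamma(a + k) Gamma(c + k), that is, up to the nonzero factor
    Gamma(a) Gamma(c), the product of rising factorials [(a)_k (c)_k]
    ([macdonald_moment], [gamma_rising]).  For [rho_(nu + 1)] the same moment
    acquires the extra factor [c + k].

    Let [T] be the operator multiplying the coefficient of [x^k] by
    [(a)_k (c)_k] ([twist]), and let [theta = x d/dx], so that [theta + c]
    multiplies that coefficient by [c + k] ([euler]).  Up to the factor
    Gamma(a) Gamma(c), integrating a polynomial [q] against
    [x^alpha rho_nu] is evaluating [T q] at 1, and integrating it against
    [x^alpha rho_(nu + 1)] is evaluating [(theta + c) T q] at 1.  Moreover [T]
    intertwines multiplication by [x] with the differential operator
    [x (theta + a) (theta + c)] ([twistXM]).  Hence the [n] orthogonality
    conditions on [P_n] say that [T P_n], and its images under the first [n - 1]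
    products of the alternating factors [theta + c], [x (theta + a)],
    [theta + c], ..., vanish at 1.  Each factor lowers the order of vanishing at
    1 by exactly one ([euler_XsubC1]), so these conditions amount to
    [(x - 1)^n] dividing [T P_n] ([XsubC1_exp_factor]); comparing degrees and
    leading coefficients,

      [T P_n = (a)_n (c)_n (x - 1)^n]   ([twist_mop]).

    Since [T] is injective, the recurrence can be checked after applying [T].
    There its left-hand side is [x (theta + a) (theta + c) (x - 1)^n], whose
    expansion in powers of [x - 1] has only the exponents [n + 1], [n], [n - 1]
    and [n - 2] ([XM_euler2_XsubC1_exp]).  This is why there are four terms, and
    the coefficients are read off from that expansion. *)

(** * Polynomials twisted by rising factorials *)

Section twisted_polynomials.
Variable R : numFieldType.
Implicit Types (a c : R) (p q s : {poly R}) (i j k m n : nat).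

Definition rising a n : R := \prod_(i < n) (a + i%:R).

Lemma risingS a n : rising a n.+1 = rising a n * (a + n%:R).
Proof. by rewrite /rising big_ord_recr. Qed.

Lemma rising_gt0 a n : 0 < a -> 0 < rising a n.
Proof. by move=> a0; apply: prodr_gt0 => i _; rewrite ltr_wpDr. Qed.

Definition twist a c p : {poly R} :=
  \poly_(k < size p) (rising a k * rising c k * p`_k).

Lemma coef_twist a c p k : (twist a c p)`_k = rising a k * rising c k * p`_k.
Proof.
by rewrite coef_poly; case: ltnP => // /(nth_default 0) ->; rewrite mulr0.
Qed.

Lemma twistD a c p q : twist a c (p + q) = twist a c p + twist a c q.
Proof. by apply/polyP => k; rewrite coefD !coef_twist coefD mulrDr. Qed.

Lemma twistZ a c x p : twist a c (x *: p) = x *: twist a c p.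
Proof. by apply/polyP => k; rewrite coefZ !coef_twist coefZ mulrCA. Qed.

Lemma twist_inj a c : 0 < a -> 0 < c -> injective (twist a c).
Proof.
move=> a0 c0 p q /polyP pq; apply/polyP => k; move: (pq k); rewrite !coef_twist.
by apply: mulfI; rewrite mulf_neq0 ?gt_eqF ?rising_gt0.
Qed.

(** The operator [theta + a], where [theta = x d/dx]. *)
Definition euler a p : {poly R} := 'X * p^`() + a *: p.

Lemma coef_euler a p k : (euler a p)`_k = (a + k%:R) * p`_k.
Proof.
rewrite coefD coefZ mulrC coefMX mulrDl addrC; congr (_ + _).
by case: k => [|k]; rewrite ?mul0r//= coef_deriv mulr_natl.
Qed.

(** Multiplying by ['X] shifts the coefficients, and consecutive weights have
    the ratio [(a + k) (c + k)], which is what the two Euler operators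
    produce. *)
Lemma twistXM a c p :
  twist a c ('X * p) = 'X * euler a (euler c (twist a c p)).
Proof.
apply/polyP => k; rewrite coef_twist !['X * _]mulrC !coefMX.
case: k => [|k] /=; rewrite ?mulr0// !coef_euler coef_twist !risingS; ring.
Qed.

Lemma eulerZ a x p : euler a (x *: p) = x *: euler a p.
Proof. by rewrite /euler derivZ scalerDr -!scalerAr !scalerA [a * x]mulrC. Qed.

(** The order of vanishing at 1 drops by exactly one: the derivative is the only
    part of [theta + a] that lowers it, and the factor [x] of [theta] equals 1
    there.  The value of the cofactor at 1 is tracked so that the lemma can be
    iterated. *)
Lemma euler_XsubC1 a m s : exists2 s', euler a (('X - 1) ^+ m.+1 * s) =
  ('X - 1) ^+ m * s' & s'.[1] = m.+1%:R * s.[1].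
Proof.
exists ('X * (m.+1%:R *: s + ('X - 1) * s^`()) + a *: (('X - 1) * s)).
  rewrite /euler derivM deriv_exp derivB derivX derivC subr0 mul1r /=.
  rewrite -!mul_polyC polyC_natr -mulr_natl exprS; ring.
by rewrite !hornerE /=; ring.
Qed.

(** The first [m] of the operators [theta + c], [x (theta + a)], [theta + c],
    [x (theta + a)], ... applied to [p].  Two consecutive ones make up the
    operator that corresponds to multiplication by ['X], and the intermediate
    stages correspond to the weight of index [nu + 1]; when [p] is a twisted
    polynomial, the values at 1 of the successive stages are therefore, up to a
    constant factor, the integrals in the two families of orthogonality
    relations, listed alternately. *)
Definition alternate a c p m : {poly R} :=
  iteri m (fun i q => if odd i then 'X * euler a q else euler c q) p.

Lemma alternate_double a c p j :
  alternate a c p j.*2 = iter j (fun q => 'X * euler a (euler c q)) p.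
Proof. by elim: j => //= j; rewrite /alternate /= odd_double => ->. Qed.

Lemma twist_iter a c p j :
  twist a c ('X^j * p) = alternate a c (twist a c p) j.*2.
Proof.
rewrite alternate_double; elim: j => [|j /= <-]; first by rewrite mul1r.
by rewrite exprS -mulrA twistXM.
Qed.

Lemma alternate_XsubC1 a c m s i : exists2 s',
  alternate a c (('X - 1) ^+ (i + m) * s) i = ('X - 1) ^+ m * s' &
  (s'.[1] == 0) = (s.[1] == 0).
Proof.
elim: i m => [|i IHi] m; first by exists s.
have [s1 /= e1 z1] := IHi m.+1; rewrite addnS in e1.
rewrite /alternate addSn /= -/(alternate _ _ _ _) e1; case: (odd i).
  have [s2 e2 z2] := euler_XsubC1 a m s1; exists ('X * s2).
    by rewrite e2 mulrCA.
  by rewrite !hornerE z2 mulf_eq0 pnatr_eq0 z1.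
have [s2 e2 z2] := euler_XsubC1 c m s1; exists s2 => //.
by rewrite z2 mulf_eq0 pnatr_eq0 z1.
Qed.

(** Once [(x - 1)^n] divides [p], the [n]-th stage evaluated at 1 is a nonzero
    multiple of the cofactor of [p] at 1, so that its vanishing provides one
    more factor [x - 1]. *)
Lemma XsubC1_exp_factor a c p n :
  (forall m, (m < n)%N -> (alternate a c p m).[1] = 0) ->
  exists s, p = ('X - 1) ^+ n * s.
Proof.
elim: n => [|n IHn] p0; first by exists p; rewrite mul1r.
have [m mn|s ps] := IHn; first by apply: p0; rewrite ltnS ltnW.
have [s'] := alternate_XsubC1 a c 0 s n; rewrite addn0 -ps mul1r => e z.
move/eqP: (p0 n (leqnn _)); rewrite e z => /factor_theorem[u su].
by exists u; rewrite ps su polyC1 [u * _]mulrC mulrA -exprSr.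
Qed.

Lemma twist_eq_XsubC1_exp a c p n : p \is monic -> size p = n.+1 ->
  (forall m, (m < n)%N -> (alternate a c (twist a c p) m).[1] = 0) ->
  twist a c p = (rising a n * rising c n) *: ('X - 1) ^+ n.
Proof.
move=> p_monic sp /XsubC1_exp_factor[s ps].
have [x sx] : exists x, s = x%:P.
  (* [twist] does not raise the degree, so no room is left for the cofactor. *)
  exists s`_0; apply: size1_polyC.
  have [-> | s0] := eqVneq s 0; first by rewrite size_poly0.
  have : (size (twist a c p) <= n.+1)%N by rewrite -sp size_poly.
  rewrite ps -polyC1 size_monicM ?monic_exp ?monicXsubC//.
  by rewrite size_exp_XsubC addSn /= -[n.+1]addn1 leq_add2l.
suff <- : x = rising a n * rising c n by rewrite ps sx mulrC mul_polyC.
have /(congr1 (fun q : {poly R} => q`_n)) := ps.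
rewrite coef_twist sx coefMC -polyC1.
have := monicP (monic_exp n (monicXsubC (1 : R))).
rewrite lead_coefE size_exp_XsubC /= => ->; rewrite mul1r => <-.
by move: (monicP p_monic); rewrite lead_coefE sp /= => ->; rewrite mulr1.
Qed.

(** In the variable [Y = 'X - 1] the operator [theta] is [(Y + 1) d/dY], so
    [theta Y^n = n Y^n + n Y^(n - 1)].  When an exponent is truncated at 0 the
    coefficient in front of it vanishes. *)
Lemma XM_euler2_XsubC1_exp a c n (Y := 'X - 1 : {poly R}) :
  'X * euler a (euler c (Y ^+ n)) =
  ((a + n%:R) * (c + n%:R)) *: Y ^+ n.+1 +
  ((n%:R + a) * (n%:R + c) + n%:R * (n%:R + c) + n%:R * (n%:R - 1 + a))
    *: Y ^+ n +
  (n%:R * (3 * n%:R - 2 + a + c)) *: Y ^+ n.-1 +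
  (n%:R * (n%:R - 1)) *: Y ^+ n.-2.
Proof.
have dY k : (Y ^+ k)^`() = k%:R *: Y ^+ k.-1.
  by rewrite deriv_exp derivB derivX derivC subr0 mul1r scaler_nat.
have XY : 'X = Y + 1 by rewrite subrK.
rewrite /euler !(derivD, derivZ, derivM, dY, derivX) {}XY -!mul_polyC.
case: n => [|[|n]] /=; rewrite ?(expr0, expr1, exprS, derivC);
  rewrite !(polyC_natr, polyCD, polyCM, polyCN, polyC0, polyC1); ring.
Qed.
End twisted_polynomials.

(** * Integration over the half-line *)

Section half_line.
Local Open Scope classical_set_scope.
Context {R : realType}.
Implicit Types (s t x y : R).
Let mu := @lebesgue_measure R.
Local Notation Rp := (`]0%R, +oo[%classic : set R).
Local Open Scope ereal_scope.

(** The preimage of an interval under dilation by [t] is [t] times shorter, and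
    Lebesgue measure is determined by its values on intervals.  Going through
    the measure requires no regularity of [f] at 0, where [x^(s - 1)] may be
    singular. *)
Lemma ge0_integral_scale (f : R -> \bar R) t : (0 < t)%R ->
  measurable_fun Rp f -> (forall x, Rp x -> 0 <= f x) ->
  \int[mu]_(x in Rp) f x = t%:E * \int[mu]_(x in Rp) f (t * x)%R.
Proof.
move=> t0 mf f0.
pose phi : measurableTypeR R -> measurableTypeR R := fun x => (t * x)%R.
have mphi : measurable_fun setT phi by exact: mulrl_measurable.
have phiRp : phi @^-1` Rp = Rp.
  by apply/seteqP; split => x /=; rewrite !in_itv/= !andbT pmulr_rgt0.
pose tn : {nonneg R} := NngNum (ltW t0).
have [nu nuE] : exists nu : {measure set (measurableTypeR R) -> \bar R},
    (nu : set _ -> \bar R) = pushforward mu phi.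
  by unshelve eexists (pushforward mu phi).
have mu_scale A : measurable A -> mu A = mscale tn nu A.
  apply: lebesgue_measure_unique => _ [[a b] _ <-].
  have phiab : phi @^-1` `]a, b]%classic = `](a / t)%R, (b / t)%R]%classic.
    apply/seteqP; split => x /=; rewrite !in_itv/= ltr_pdivrMr// ler_pdivlMr//;
      by rewrite mulrC.
  transitivity (t%:E * mu (phi @^-1` `]a, b]%classic)); last first.
    by rewrite -[RHS]/(t%:E * nu `]a, b]%classic) nuE.
  rewrite phiab.
  rewrite /mu/= !lebesgue_measure_itv/= !lte_fin ltr_pM2r ?invr_gt0//.
  case: ifP => _; last by rewrite mule0.
  by rewrite -!EFinB -EFinM -mulrBl mulrC divfK// gt_eqF.
transitivity (\int[mscale tn nu]_(x in Rp) f x).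
  by apply: eq_measure_integral => A mA _; exact: mu_scale.
rewrite ge0_integral_mscale//= nuE ge0_integral_pushforward//=.
  by rewrite phiRp.
by move=> x /set_mem; exact: f0.
Qed.

Lemma ge0_tonelli_prod (A B : set R) (f : R -> R -> R) :
  measurable A -> measurable B ->
  measurable_fun setT (fun z : R * R => f z.1 z.2) ->
  (forall x y, A x -> B y -> (0 <= f x y)%R) ->
  \int[mu]_(x in A) \int[mu]_(y in B) (f x y)%:E =
  \int[mu]_(y in B) \int[mu]_(x in A) (f x y)%:E.
Proof.
move=> mA mB mf f0.
pose g := (fun z : R * R => (f z.1 z.2)%:E) \_ (A `*` B).
have mg : measurable_fun setT g.
  apply/(measurable_restrictT _ (measurableX mA mB)).
  exact/measurable_funTS/measurable_EFinP.
have g0 z : 0 <= g z.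
  by rewrite /g patchE; case: ifPn => // /set_mem[? ?]; rewrite lee_fin f0.
have gE x y : g (x, y) = if (x \in A) && (y \in B) then (f x y)%:E else 0.
  by rewrite /g patchE in_setX.
transitivity (\int[mu]_x \int[mu]_y g (x, y)); last first.
  rewrite (@fubini_tonelli _ _ _ _ _ mu mu g mg g0).
  rewrite [RHS]integral_mkcond; apply: eq_integral => x _.
  rewrite patchE; case: ifPn => xA.
    rewrite [RHS]integral_mkcond; apply: eq_integral => y _.
    by rewrite gE xA/= patchE andbT.
  by rewrite integral0_eq// => y _; rewrite gE (negbTE xA) andbF.
rewrite [LHS]integral_mkcond; apply: eq_integral => x _.
rewrite patchE; case: ifPn => xA.
  rewrite [LHS]integral_mkcond; apply: eq_integral => y _.
  by rewrite gE xA/= patchE.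
by rewrite [RHS]integral0_eq// => y _; rewrite gE (negbTE xA).
Qed.

Lemma integral_expRM_y x a : (0 < x)%R ->
  \int[mu]_(l in `[a, +oo[) (x * expR (- (l * x)))%:E = (expR (- (a * x)))%:E.
Proof.
move=> x0.
have dF (l : R) : is_derive l 1%R (fun l : R => - expR (- (l * x)))%R
    (x * expR (- (l * x)))%R.
  by apply: is_derive_eq; rewrite /GRing.scale/=; ring.
have cF : continuous (fun l : R => expR (- (l * x)))%R.
  move=> l; apply: continuous_comp; last exact: continuous_expR.
  by apply: continuousN; apply: cvgMr_tmp; exact: cvg_id.
rewrite (@ge0_continuous_FTC2y R _ (fun l : R => - expR (- (l * x)))%R _ 0%R).
- by rewrite sub0e EFinN oppeK.
- by move=> l _; rewrite mulr_ge0 ?expR_ge0 ?ltW.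
- by apply: continuous_subspaceT => l; apply: cvgMl_tmp; exact: cF.
- rewrite -oppr0; apply: cvgN.
  apply: (cvg_comp (fun l : R => l * x)%R (fun l : R => expR (- l)));
    last exact: cvgr_expR.
  by apply: gt0_cvgMly => //; exact: cvg_id.
- by move=> l _; exact: ex_derive.
- by apply: cvg_at_right_filter; apply: cvgN; exact: cF.
- by move=> l _; rewrite derive1E derive_val.
Qed.

Lemma powR_cvgy0 s : (0 < s)%R -> ((l : R) `^ (- s) @[l --> +oo] --> (0 : R))%R.
Proof.
move=> s0.
rewrite (_ : (fun l => _) = (fun l : R => (l `^ s)^-1)%R); last first.
  by apply/funext => l /=; rewrite powRN.
apply/(@gtr0_cvgV0 _ _ _ _ (fun l : R => l `^ s)%R).
  by near=> l; rewrite powR_gt0.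
apply/cvgryPge => A; near=> l.
apply: (@le_trans _ _ ((Num.max A 1) `^ s^-1 `^ s)%R).
  by rewrite -powRrM mulVf ?gt_eqF// powRr1 ?le_max ?lexx// ler01 orbT.
by rewrite ge0_ler_powR ?nnegrE ?powR_ge0 ?(ltW s0).
Unshelve. all: by end_near. Qed.

Lemma integral_powR_1y s : (0 < s)%R ->
  \int[mu]_(l in `[1%R, +oo[) (s * l `^ (- s - 1))%:E = 1.
Proof.
move=> s0.
have dF (l : R) : (0 < l)%R -> is_derive l 1%R (fun l : R => - l `^ (- s))%R
    (s * l `^ (- s - 1))%R.
  move=> l0; have := is_derive1_powR (- s) l0 => dl.
  by apply: is_derive_eq; ring.
have cF p (l : R) : (0 < l)%R -> {for l, continuous (fun l : R => l `^ p)%R}.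
  move=> l0; apply: differentiable_continuous; apply/derivable1_diffP.
  by apply: derivable_powR; rewrite in_itv/= l0.
rewrite (@ge0_continuous_FTC2y R _ (fun l : R => - l `^ (- s))%R _ 0%R).
- by rewrite sub0e EFinN oppeK powR1.
- by move=> l _; rewrite mulr_ge0 ?powR_ge0 ?ltW.
- apply: continuous_in_subspaceT => l /set_mem /=; rewrite in_itv/= andbT => l1.
  by apply: cvgMl_tmp; apply: cF; exact: lt_le_trans l1.
- by rewrite -oppr0; apply: cvgN; exact: powR_cvgy0.
- by move=> l l1; apply: ex_derive; apply: dF; exact: lt_trans l1.
- by apply: cvg_at_right_filter; apply: cvgN; apply: cF.
- move=> l; rewrite in_itv/= andbT => l1; rewrite derive1E.
  by have /@derive_val := dF l (lt_trans ltr01 l1).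
Qed.
End half_line.

(** * The Gamma function *)

Section euler_gamma.
Local Open Scope classical_set_scope.
Context {R : realType}.
Implicit Types (s t x : R).
Let mu := @lebesgue_measure R.
Local Notation Rp := (`]0%R, +oo[%classic : set R).
Local Open Scope ereal_scope.

(** With values in the extended reals, the functional equation can be derived
    from Tonelli's theorem before convergence is known, and convergence is in
    turn deduced from it. *)
Definition egamma s : \bar R :=
  \int[mu]_(x in Rp) (x `^ (s - 1) * expR (- x))%:E.

Lemma measurable_egamma_integrand s (D : set R) :
  measurable_fun D (fun x : R => (x `^ (s - 1) * expR (- x))%:E).
Proof.
apply/measurable_EFinP/measurable_funTS.
by apply: measurable_funM => //; exact: measurableT_comp.
Qed.

Lemma measurable_laplace_integrand s :
  measurable_fun setT (fun z : R * R => z.2 `^ s * expR (- (z.1 * z.2)))%R.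
Proof.
apply: measurable_funM.
  exact: (measurableT_comp (measurable_powR s) measurable_snd).
apply: measurableT_comp => //; apply: measurableT_comp => //.
exact: measurable_funM.
Qed.

Lemma egamma_ge0 s : 0 <= egamma s.
Proof.
by apply: integral_ge0 => x _; rewrite lee_fin mulr_ge0 ?powR_ge0 ?expR_ge0.
Qed.

Lemma egamma_laplace s t : (0 < t)%R ->
  \int[mu]_(x in Rp) (x `^ (s - 1) * expR (- (t * x)))%:E =
  (t `^ (- s))%:E * egamma s.
Proof.
move=> t0; rewrite /egamma [in RHS](@ge0_integral_scale R _ t)//; last 2 first.
- exact: measurable_egamma_integrand.
- by move=> x _; rewrite lee_fin mulr_ge0 ?powR_ge0 ?expR_ge0.
rewrite muleA -EFinM -ge0_integralZl_EFin//; first last.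
- by rewrite mulr_ge0 ?powR_ge0 ?ltW.
- apply/measurable_EFinP/measurable_funTS; apply: measurable_funM => /=.
    exact: (measurableT_comp (measurable_powR _) (mulrl_measurable t)).
  by do 2 apply: measurableT_comp => //; exact: mulrl_measurable.
- by move=> x _; rewrite lee_fin mulr_ge0 ?powR_ge0 ?expR_ge0.
apply: eq_integral => x /set_mem /=; rewrite in_itv/= andbT => x0.
rewrite -EFinM powRM ?ltW//; congr EFin.
suff : (t `^ (- s) * t * t `^ (s - 1) = 1)%R.
  by move=> e; rewrite 2!mulrA e mul1r.
rewrite -[X in (_ * X * _)%R](powRr1 (ltW t0)).
have t_neq0 : (t != 0)%R by rewrite gt_eqF.
rewrite -!powRD ?t_neq0 ?implybT//.
by rewrite (_ : (- s + 1 + (s - 1) = 0)%R) ?powRr0//; ring.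
Qed.

(** Integrate [s x^s e^(- l x)] over [x > 0] and [l > 1] in both orders: the
    integral over [x] is [s l^(- s - 1) Gamma(s + 1)], the integral over [l] is
    [s x^(s - 1) e^(- x)].  Unlike integration by parts in [x], this only needs
    the fundamental theorem of calculus in [l], on a range that stays away from
    the singularity at 0. *)
Lemma egammaS s : (0 < s)%R -> egamma (s + 1) = s%:E * egamma s.
Proof.
move=> s0; rewrite -[LHS]mule1 -(integral_powR_1y s0).
rewrite -ge0_integralZl//; first last.
- exact: egamma_ge0.
- by move=> x _; rewrite lee_fin mulr_ge0 ?powR_ge0 ?ltW.
- apply/measurable_EFinP/measurable_funTS; exact: measurable_funM.
transitivity (\int[mu]_(l in `[1%R, +oo[) \int[mu]_(x in Rp)
    (s * (x `^ (s + 1 - 1) * expR (- (l * x))))%:E).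
  apply: eq_integral => l /set_mem /=; rewrite in_itv/= andbT => l1.
  under eq_integral do rewrite EFinM.
  rewrite ge0_integralZl_EFin ?(ltW s0)//; first last.
  - apply/measurable_EFinP/measurable_funTS; apply: measurable_funM => //.
    by do 2 apply: measurableT_comp => //; exact: mulrl_measurable.
  - by move=> x _; rewrite lee_fin mulr_ge0 ?powR_ge0 ?expR_ge0.
  rewrite egamma_laplace ?(lt_le_trans _ l1)// opprD muleC muleA -EFinM.
  by congr (_ * _); rewrite mulrC.
rewrite ge0_tonelli_prod//; last 2 first.
- apply: measurable_funM => //; exact: measurable_laplace_integrand.
- by move=> l x _ _; rewrite !mulr_ge0 ?powR_ge0 ?expR_ge0 ?ltW.
rewrite /egamma -ge0_integralZl_EFin ?(ltW s0)//; first last.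
- exact: measurable_egamma_integrand.
- by move=> x _; rewrite lee_fin mulr_ge0 ?powR_ge0 ?expR_ge0.
apply: eq_integral => x /set_mem /=; rewrite in_itv/= andbT => x0.
rewrite -EFinM mulrA EFinM -[X in expR (- X)]mul1r -(integral_expRM_y 1%R x0).
rewrite -ge0_integralZl_EFin//; first last.
- by rewrite mulr_ge0 ?powR_ge0 ?ltW.
- apply/measurable_EFinP/measurable_funTS; apply: measurable_funM => //.
  do 2 apply: measurableT_comp => //.
  exact: measurable_funM.
- by move=> l _; rewrite lee_fin mulr_ge0 ?expR_ge0 ?ltW.
apply: eq_integral => l _; rewrite -EFinM addrK; congr EFin.
rewrite [RHS]mulrA -[in RHS](mulrA s) [(_ `^ (s - 1) * x)%R]mulrC.
by rewrite mulr_powRB1 ?ltW// mulrA.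
Qed.

Lemma egamma1 : egamma 1 = 1.
Proof.
rewrite /egamma -[RHS](_ : (expR (- (0 * 1)))%R%:E = 1); last first.
  by rewrite mul0r oppr0 expR0.
rewrite -(integral_expRM_y 0%R ltr01) -integral_itv_obnd_cbnd; last first.
  apply/measurable_EFinP/measurable_funTS; apply: measurable_funM => //.
  do 2 apply: measurableT_comp => //.
  exact: measurable_funM.
by apply: eq_integral => x _; rewrite subrr powRr0 mulr1.
Qed.

(** The functional equation gives finiteness at the positive integers and
    reduces [s] to [s + 1]; there the power [x^s] is at most [1 + x^n] for any
    integer [n >= s], so that Gamma(1) + Gamma(n + 1) is a bound. *)
Lemma egamma_fin s : (0 < s)%R -> egamma s < +oo.
Proof.
have gammaN n : egamma n.+1%:R < +oo.
  elim: n => [|n IHn]; first by rewrite egamma1 ltry.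
  by rewrite -natr1 egammaS// lte_mul_pinfty// lee_fin.
move=> s0; suff : egamma (s + 1) < +oo.
  rewrite egammaS//; apply: contraTT; rewrite -!leNgt !leye_eq => /eqP ->.
  by rewrite gt0_muley// lte_fin.
pose n := Num.bound s.
apply: (@le_lt_trans _ _ (egamma 1 + egamma n.+1%:R)); last first.
  by apply: lte_add_pinfty; [rewrite egamma1 ltry | exact: gammaN].
rewrite /egamma -ge0_integralD//; first last.
- exact: measurable_egamma_integrand.
- by move=> x _; rewrite lee_fin mulr_ge0 ?powR_ge0 ?expR_ge0.
- exact: measurable_egamma_integrand.
- by move=> x _; rewrite lee_fin mulr_ge0 ?powR_ge0 ?expR_ge0.
apply: ge0_le_integral => //=.
- by move=> x _; rewrite lee_fin mulr_ge0 ?powR_ge0 ?expR_ge0.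
- exact: measurable_egamma_integrand.
- by apply: emeasurable_funD; exact: measurable_egamma_integrand.
move=> x; rewrite in_itv/= andbT => x0.
rewrite -EFinD lee_fin -mulrDl ler_wpM2r ?expR_ge0// subrr powRr0 -natr1 !addrK.
have [x1|/ltW x1] := lerP x 1.
  have one_pow : (1 `^ s = 1 :> R)%R by rewrite powR1.
  rewrite ler_wpDr ?powR_ge0// -[leRHS]one_pow.
  by rewrite ge0_ler_powR ?nnegrE ?(ltW x0) ?(ltW s0) ?ler01.
by rewrite ler_wpDl// ler_powR// ltW// archi_boundP// ltW.
Qed.

(** A positive function has a nonzero integral over a set of positive
    measure. *)
Lemma egamma_neq0 s : egamma s != 0.
Proof.
apply/eqP => gs0.
have : ae_eq mu Rp (EFin \o (fun x : R => x `^ (s - 1) * expR (- x))%R) (cst 0).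
  apply/ae_eq_integral_abs => //.
    exact: measurable_egamma_integrand.
  rewrite -[RHS]gs0; apply: eq_integral => x _.
  by rewrite gee0_abs// lee_fin mulr_ge0 ?powR_ge0 ?expR_ge0.
move=> [N [mN N0 sub]].
have : mu Rp <= 0.
  rewrite -N0; apply: le_measure; rewrite ?inE//.
  apply: subset_trans sub => x /= x0 /(_ x0) [] /eqP.
  move: x0; rewrite in_itv/= andbT => x0.
  by rewrite gt_eqF// mulr_gt0 ?powR_gt0 ?expR_gt0.
by rewrite /mu/= lebesgue_measure_itv/= ltry leye_eq.
Qed.

Local Close Scope ereal_scope.

Definition gamma s : R := fine (egamma s).

Lemma egammaE s : 0 < s -> egamma s = (gamma s)%:E.
Proof. by move=> s0; rewrite fineK// ge0_fin_numE ?egamma_ge0// egamma_fin. Qed.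

Lemma gamma_neq0 s : 0 < s -> gamma s != 0.
Proof. by move=> s0; have := egamma_neq0 s; rewrite egammaE. Qed.

Lemma gammaS s : 0 < s -> gamma (s + 1) = s * gamma s.
Proof. by move=> s0; rewrite /gamma egammaS// egammaE. Qed.

Lemma gamma_rising s n : 0 < s -> gamma (s + n%:R) = gamma s * rising s n.
Proof.
move=> s0; elim: n => [|n IHn]; first by rewrite addr0 /rising big_ord0 mulr1.
by rewrite -natr1 addrA gammaS ?ltr_wpDr// IHn risingS; ring.
Qed.
End euler_gamma.

(** * Moments of the Macdonald weights *)

Section macdonald_moments.
Local Open Scope classical_set_scope.
Context {R : realType}.
Implicit Types (nu s t x y : R).
Let mu := @lebesgue_measure R.
Local Notation Rp := (`]0%R, +oo[%classic : set R).

(** The integrand of the Macdonald function at [z = 2 sqrt x].  The inverse of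
    [t] is written as a real power, to reuse the measurability of powers. *)
Definition macdonald_kernel nu x t : R :=
  t `^ (- nu - 1) * expR (- t) * expR (- (t `^ (-1) * x)).

Lemma macdonald_kernel_ge0 nu x t : 0 <= macdonald_kernel nu x t.
Proof. by rewrite !mulr_ge0 ?powR_ge0 ?expR_ge0. Qed.

Lemma measurable_macdonald_kernel nu :
  measurable_fun setT (fun z : R * R => macdonald_kernel nu z.1 z.2).
Proof.
apply: measurable_funM.
  apply: measurable_funM.
    exact: (measurableT_comp (measurable_powR _) measurable_snd).
  by apply: measurableT_comp => //; exact: measurableT_comp.
do 2 apply: measurableT_comp => //; apply: measurable_funM => //.
exact: (measurableT_comp (measurable_powR _) measurable_snd).
Qed.

Local Open Scope ereal_scope.

Definition emacdonald nu x := \int[mu]_(t in Rp) (macdonald_kernel nu x t)%:E.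

Lemma emacdonald_ge0 nu x : 0 <= emacdonald nu x.
Proof. by apply: integral_ge0 => t _; rewrite lee_fin macdonald_kernel_ge0. Qed.

Lemma measurable_emacdonald nu (D : set R) : measurable_fun D (emacdonald nu).
Proof.
apply: measurable_funTS.
pose g := (fun z : R * R => (macdonald_kernel nu z.1 z.2)%:E) \_ (setT `*` Rp).
have mg : measurable_fun setT g.
  apply/(measurable_restrictT _ (measurableX measurableT (measurable_itv _))).
  apply: measurable_funTS; apply/measurable_EFinP.
  exact: measurable_macdonald_kernel.
have g0 z : 0 <= g z.
  rewrite /g patchE; case: ifPn => // _.
  by rewrite lee_fin macdonald_kernel_ge0.
have := @measurable_fun_fubini_tonelli_F _ _ _ _ _ mu g mg g0.
apply: eq_measurable_fun => x _.
rewrite /fubini_F /emacdonald [RHS]integral_mkcond; apply: eq_integral => t _.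
by rewrite /g !patchE in_setX in_setT.
Qed.

Lemma scaled_macdonaldE nu x : (0 < x)%R ->
  scaled_macdonald nu x = (x `^ nu * fine (emacdonald nu x))%R.
Proof.
move=> x0; have x_neq0 : (x != 0)%R by rewrite gt_eqF.
have half_sqrt : (2 * Num.sqrt x / 2 = x `^ 2^-1)%R.
  by rewrite powR12_sqrt ?ltW//; field.
have powM : (x `^ (nu / 2) * (2 * Num.sqrt x / 2) `^ nu = x `^ nu)%R.
  rewrite half_sqrt -powRrM -powRD ?x_neq0 ?implybT//.
  by congr (_ `^ _)%R; field.
rewrite /scaled_macdonald /macdonald /Rintegral -powM.
rewrite (_ : \int[_]_(t in _) _ = emacdonald nu x); first by field.
apply: eq_integral => t /set_mem /=; rewrite in_itv/= andbT => t0.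
congr EFin; rewrite /macdonald_kernel expRD powR_inv1 ?ltW//.
rewrite exprMn sqr_sqrtr ?ltW// (_ : _ / (4 * t) = t^-1 * x)%R; first by ring.
by field; rewrite gt_eqF.
Qed.

(** Integrating first over [x] leaves [t^(s + nu) Gamma(s + nu)], by dilation;
    with the factor [t^(- nu - 1) e^(- t)] the integral over [t] is then the one
    defining Gamma(s). *)
Lemma integral_emacdonald nu s :
  \int[mu]_(x in Rp) ((x `^ (s + nu - 1))%:E * emacdonald nu x) =
  egamma s * egamma (s + nu).
Proof.
transitivity (\int[mu]_(x in Rp) \int[mu]_(t in Rp)
    (x `^ (s + nu - 1) * macdonald_kernel nu x t)%:E).
  apply: eq_integral => x _; rewrite -ge0_integralZl_EFin ?powR_ge0//.
  - by move=> t _; rewrite lee_fin macdonald_kernel_ge0.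
  - apply/measurable_EFinP/measurable_funTS.
    by have := measurableT_comp (measurable_macdonald_kernel nu)
      (pair1_measurable x).
rewrite ge0_tonelli_prod//; last 2 first.
- apply: measurable_funM; last exact: measurable_macdonald_kernel.
  exact: (measurableT_comp (measurable_powR _) measurable_fst).
- by move=> x t _ _; rewrite mulr_ge0 ?powR_ge0 ?macdonald_kernel_ge0.
rewrite -ge0_integralZr ?egamma_ge0//; first last.
- by move=> x _; rewrite lee_fin mulr_ge0 ?powR_ge0 ?expR_ge0.
- exact: measurable_egamma_integrand.
apply: eq_integral => t /set_mem /=; rewrite in_itv/= andbT => t0.
have t_neq0 : (t != 0)%R by rewrite gt_eqF.
have tV_gt0 : (0 < t `^ (-1))%R by rewrite powR_gt0.
transitivity ((t `^ (- nu - 1) * expR (- t))%:E *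
    \int[mu]_(x in Rp) (x `^ (s + nu - 1) * expR (- (t `^ (-1) * x)))%:E).
  rewrite -ge0_integralZl_EFin//; first last.
  - by rewrite mulr_ge0 ?powR_ge0 ?expR_ge0.
  - apply/measurable_EFinP/measurable_funTS; apply: measurable_funM => //.
    by do 2 apply: measurableT_comp => //; exact: mulrl_measurable.
  - by move=> x _; rewrite lee_fin mulr_ge0 ?powR_ge0 ?expR_ge0.
  apply: eq_integral => x _; rewrite -EFinM; congr EFin.
  by rewrite /macdonald_kernel mulrCA.
rewrite egamma_laplace// muleA -EFinM -powRrM; congr (_%:E * _).
rewrite mulrAC -powRD ?t_neq0 ?implybT//; congr (_ `^ _ * _)%R; ring.
Qed.

Lemma measurable_scaled_macdonald nu : measurable_fun Rp (scaled_macdonald nu).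
Proof.
apply: (eq_measurable_fun (fun x => x `^ nu * fine (emacdonald nu x))%R).
  move=> x /set_mem /=; rewrite in_itv/= andbT => x0.
  by rewrite scaled_macdonaldE.
apply: measurable_funM; first exact: measurable_funTS.
apply: (measurableT_comp (fine_measurable _)) => //.
exact: measurable_emacdonald.
Qed.

(** The weight is defined by a real-valued integral, which would be 0 where the
    extended one is infinite.  The finiteness of the double integral excludes
    this for almost every [x], and that is all the moments can see. *)
Lemma macdonald_moment nu s : (0 <= nu)%R -> (0 < s)%R ->
  mu.-integrable Rp (fun x => (scaled_macdonald nu x * x `^ (s - 1))%:E) /\
  \int[mu]_(x in Rp) (scaled_macdonald nu x * x `^ (s - 1))%:E =
    (gamma s * gamma (s + nu))%:E.
Proof.
move=> nu0 s0; have snu0 : (0 < s + nu)%R by rewrite ltr_wpDr.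
have mRp : measurable (Rp : set (measurableTypeR R)) by exact: measurable_itv.
pose f x : \bar R := (x `^ (s + nu - 1))%:E * emacdonald nu x.
pose g x : R := (scaled_macdonald nu x * x `^ (s - 1))%R.
have f0 x : 0 <= f x by rewrite mule_ge0 ?lee_fin ?powR_ge0 ?emacdonald_ge0.
have mf : measurable_fun Rp f.
  apply: emeasurable_funM; last exact: measurable_emacdonald.
  by apply/measurable_EFinP/measurable_funTS.
have intf : \int[mu]_(x in Rp) f x = (gamma s * gamma (s + nu))%:E.
  by rewrite integral_emacdonald !egammaE.
have intblf : mu.-integrable Rp f.
  apply/integrableP; split=> //.
  under eq_integral do rewrite gee0_abs//.
  by rewrite intf ltry.
have mg : measurable_fun Rp (EFin \o g).
  apply/measurable_EFinP; apply: measurable_funM.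
    exact: measurable_scaled_macdonald.
  exact: measurable_funTS.
have g0 x : Rp x -> 0 <= (g x)%:E.
  rewrite /= in_itv/= andbT => x0; rewrite lee_fin /g scaled_macdonaldE//.
  by rewrite !mulr_ge0 ?powR_ge0// fine_ge0// emacdonald_ge0.
have fg : ae_eq mu Rp f (EFin \o g).
  have := integrable_ae mRp intblf; apply: filterS => x /= ffin xRp.
  have := ffin xRp; move: xRp; rewrite in_itv/= andbT => x0.
  have x_neq0 : (x != 0)%R by rewrite gt_eqF.
  have xp0 : (0 < x `^ (s + nu - 1))%R by rewrite powR_gt0.
  rewrite /f /g scaled_macdonaldE//.
  case: (emacdonald nu x) (emacdonald_ge0 nu x) => [j| |]//= _.
  - move=> _; rewrite -EFinM mulrAC -powRD ?x_neq0 ?implybT//.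
    by congr (_ `^ _ * _)%:E; ring.
  - by rewrite gt0_muley ?lte_fin.
have intg : \int[mu]_(x in Rp) (g x)%:E = (gamma s * gamma (s + nu))%:E.
  by rewrite -intf; apply/esym; exact: ge0_ae_eq_integral.
split=> //; apply/integrableP; split => //.
rewrite (_ : \int[mu]_(x in _) _ = (gamma s * gamma (s + nu))%:E) ?ltry//.
by rewrite -intg; apply: eq_integral => x /set_mem /g0 gx0; rewrite gee0_abs.
Qed.

Lemma integral_poly (w : R -> R) (m : nat -> R) (alpha : R) (p : {poly R}) :
  (forall i, mu.-integrable Rp (fun x => (w x * x `^ (i%:R + alpha))%:E) /\
    \int[mu]_(x in Rp) (w x * x `^ (i%:R + alpha))%:E = (m i)%:E) ->
  \int[mu]_(x in Rp) (p.[x] * w x * x `^ alpha)%:E =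
    (\sum_(i < size p) p`_i * m i)%:E.
Proof.
move=> wm.
transitivity (\int[mu]_(x in Rp) \sum_(i < size p)
    ((p`_i)%:E * (w x * x `^ (i%:R + alpha))%:E)).
  apply: eq_integral => x /set_mem /=; rewrite in_itv/= andbT => x0.
  have x_neq0 : (x != 0)%R by rewrite gt_eqF.
  rewrite sumEFin horner_coef !mulr_suml; congr EFin; apply: eq_bigr => i _.
  by rewrite powRD ?x_neq0 ?implybT// powR_mulrn ?ltW//; ring.
rewrite integral_sum//; last first.
  by move=> i; apply: integrableZl => //; exact: (wm i).1.
rewrite -sumEFin; apply: eq_bigr => i _.
by rewrite integralZl ?(wm i).2//; exact: (wm i).1.
Qed.
End macdonald_moments.

(** * The multiple orthogonal polynomials *)

Section orthogonality.
Context {R : realType}.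
Implicit Types (nu alpha : R) (p : {poly R}).
Local Open Scope classical_set_scope.

Lemma horner1_twist a c p :
  (twist a c p).[1] = \sum_(i < size p) p`_i * (rising a i * rising c i).
Proof.
rewrite horner_poly; apply: eq_bigr => i _.
by rewrite expr1n mulr1 mulrC.
Qed.

Lemma horner1_euler_twist a c b p :
  (euler b (twist a c p)).[1] =
  \sum_(i < size p) p`_i * ((b + i%:R) * (rising a i * rising c i)).
Proof.
rewrite (@horner_coef_wide _ (size p)); last first.
  apply/leq_sizeP => i pi; rewrite coef_euler coef_twist.
  by rewrite (nth_default 0 pi) !mulr0.
apply: eq_bigr => i _.
by rewrite coef_euler coef_twist expr1n mulr1 mulrA mulrC.
Qed.

(** The power [x^k] of the orthogonality relation is moved into the polynomial,
    because the twist sees multiplication by ['X^k] as an operator. *)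
Lemma orthogonal_uptoXM (w : R -> R) alpha n p : orthogonal_upto w alpha n p ->
  forall k, (k < n)%N -> (\int[lebesgue_measure]_(x in `]0%R, +oo[)
    (('X^k * p).[x] * w x * x `^ alpha)%:E = 0)%E.
Proof.
move=> pw k kn; rewrite -(pw k kn).
apply: eq_integral => x /set_mem /=; rewrite in_itv/= andbT => x0.
have x_neq0 : (x != 0)%R by rewrite gt_eqF.
rewrite powRD ?x_neq0 ?implybT// powR_mulrn ?ltW// hornerM hornerXn.
by congr EFin; ring.
Qed.

Lemma orthogonal_macdonald_twist nu alpha n p : 0 <= nu -> -1 < alpha ->
  orthogonal_upto (scaled_macdonald nu) alpha n p ->
  forall k, (k < n)%N ->
    (alternate (alpha + 1) (alpha + nu + 1)
      (twist (alpha + 1) (alpha + nu + 1) p) k.*2).[1] = 0.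
Proof.
move=> nu0 alpha0 orth k kn.
have a0 : 0 < alpha + 1 by rewrite -ltrBlDr sub0r.
have c0 : 0 < alpha + nu + 1 by rewrite addrAC ltr_wpDr.
have /= := orthogonal_uptoXM orth kn.
pose m (i : nat) := gamma (alpha + 1) * gamma (alpha + nu + 1) *
  (rising (alpha + 1) i * rising (alpha + nu + 1) i).
rewrite (@integral_poly _ _ m) => [[]|i].
  under eq_bigr do rewrite mulrCA.
  rewrite -mulr_sumr -horner1_twist twist_iter => /eqP.
  rewrite !mulf_eq0 (negbTE (gamma_neq0 _))// (negbTE (gamma_neq0 _))//.
  by move=> /eqP.
have s0 : 0 < i%:R + alpha + 1 by rewrite -addrA ltr_wpDl.
have := macdonald_moment nu0 s0; rewrite addrK => -[? ->]; split => //.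
rewrite (_ : i%:R + alpha + 1 = alpha + 1 + i%:R); last by ring.
rewrite (_ : alpha + 1 + i%:R + nu = alpha + nu + 1 + i%:R); last by ring.
by rewrite !gamma_rising// /m; congr EFin; ring.
Qed.

(** Raising [nu] by one multiplies the [i]-th moment by [alpha + nu + 1 + i], by
    the functional equation of Gamma; this is one more Euler operator before
    evaluating at 1. *)
Lemma orthogonal_macdonaldS_twist nu alpha n p : 0 <= nu -> -1 < alpha ->
  orthogonal_upto (scaled_macdonald (nu + 1)) alpha n p ->
  forall k, (k < n)%N ->
    (alternate (alpha + 1) (alpha + nu + 1)
      (twist (alpha + 1) (alpha + nu + 1) p) k.*2.+1).[1] = 0.
Proof.
move=> nu0 alpha0 orth k kn.
have a0 : 0 < alpha + 1 by rewrite -ltrBlDr sub0r.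
have c0 : 0 < alpha + nu + 1 by rewrite addrAC ltr_wpDr.
have /= := orthogonal_uptoXM orth kn.
pose m (i : nat) := gamma (alpha + 1) * gamma (alpha + nu + 1) *
  ((alpha + nu + 1 + i%:R) *
    (rising (alpha + 1) i * rising (alpha + nu + 1) i)).
rewrite (@integral_poly _ _ m) => [[]|i].
  under eq_bigr do rewrite mulrCA.
  rewrite -mulr_sumr -horner1_euler_twist twist_iter => /eqP.
  rewrite !mulf_eq0 (negbTE (gamma_neq0 _))// (negbTE (gamma_neq0 _))// => /eqP.
  by rewrite /alternate /= odd_double.
have s0 : 0 < i%:R + alpha + 1 by rewrite -addrA ltr_wpDl.
have := macdonald_moment (addr_ge0 nu0 ler01) s0; rewrite addrK => -[? ->].
split => //.
rewrite (_ : i%:R + alpha + 1 + (nu + 1) = alpha + nu + 1 + i%:R + 1);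
  last by ring.
rewrite (_ : i%:R + alpha + 1 = alpha + 1 + i%:R); last by ring.
have ci0 : 0 < alpha + nu + 1 + i%:R by rewrite ltr_wpDr.
by rewrite (gammaS ci0) !gamma_rising// /m; congr EFin; ring.
Qed.

(** The hypothesis on [m] and [n] makes the even stages below [n + m] those
    with index less than [n] in the first family, and the odd stages those with
    index less than [m] in the second. *)
Lemma twist_mop nu alpha n m p : 0 <= nu -> -1 < alpha -> (m <= n <= m.+1)%N ->
  is_type2_mop nu alpha n m p ->
  twist (alpha + 1) (alpha + nu + 1) p =
  (rising (alpha + 1) (n + m) * rising (alpha + nu + 1) (n + m)) *:
    ('X - 1) ^+ (n + m).
Proof.
move=> nu0 alpha0 /andP[mn nm] [p_monic sp orth0 orth1].
apply: twist_eq_XsubC1_exp => // i inm; rewrite -(odd_double_half i).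
have i2 := odd_double_half i; case: (odd i) i2 => /= i2.
  by apply: orthogonal_macdonaldS_twist orth1 _ _ => //; lia.
by apply: orthogonal_macdonald_twist orth0 _ _ => //; lia.
Qed.
End orthogonality.

Theorem theorem4 (R : realType) (nu alpha : R) (P : int -> {poly R})
    (nu_ge0 : 0 <= nu) (alpha_gt : -1 < alpha)
    (P_even : forall n : nat, is_type2_mop nu alpha n n (P (2 * n)%N%:Z))
    (P_odd : forall n : nat, is_type2_mop nu alpha n.+1 n (P (2 * n).+1%:Z))
    (P_m1 : P (-1) = 0) (P_m2 : P (-2) = 0) :
  forall n : nat,
    'X * P n%:Z = P (n%:Z + 1) + coef_b nu alpha n *: P n%:Z
                  + coef_c nu alpha n *: P (n%:Z - 1)
                  + coef_d nu alpha n *: P (n%:Z - 2).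
Proof.
have a0 : 0 < alpha + 1 by rewrite -ltrBlDr sub0r.
have c0 : 0 < alpha + nu + 1 by rewrite addrAC ltr_wpDr.
have PE n : twist (alpha + 1) (alpha + nu + 1) (P n%:Z) =
    (rising (alpha + 1) n * rising (alpha + nu + 1) n) *: ('X - 1) ^+ n.
  rewrite -(odd_double_half n); case: (odd n) => /=.
    have := twist_mop nu_ge0 alpha_gt _ (P_odd n./2).
    by rewrite leqnSn leqnn addSn addnn add1n mul2n; apply.
  have := twist_mop nu_ge0 alpha_gt _ (P_even n./2).
  by rewrite leqnSn leqnn addnn add0n mul2n; apply.
move=> n; apply: (twist_inj a0 c0); rewrite twistXM !twistD !twistZ.
rewrite (_ : n%:Z + 1 = n.+1%:Z); last by rewrite -addn1 PoszD.
rewrite !PE !eulerZ -scalerAr XM_euler2_XsubC1_exp.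
rewrite /coef_b /coef_c /coef_d !scalerDr !scalerA.
congr (_ *: _ + _ *: _ + _ + _).
- by rewrite !risingS; ring.
- by ring.
(* A term of negative index has coefficient 0 on both sides. *)
- case: n => [|n]; first by rewrite !(mul0r, mulr0, scale0r).
  rewrite (_ : n.+1%:Z - 1 = n%:Z) ?PE ?scalerA; last by lia.
  by congr (_ *: _); rewrite !risingS /=; ring.
- case: n => [|[|n]]; rewrite ?subrr ?(mul0r, mulr0, scale0r)//.
  rewrite (_ : n.+2%:Z - 2 = n%:Z) ?PE ?scalerA; last by lia.
  by congr (_ *: _); rewrite !risingS /=; ring.
Qed.
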